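(* Suppose that $f$ has the MLR property, i.e. $f(x_1-\eta_1)f(x_2-\eta_2)\ge f(x_1-\eta_2)f(x_2-\eta_1)$ whenever $x_1<x_2$ and $\eta_1<\eta_2$, and that $W$ satisfies (C1)--(C3) (listed in the context). Let $c_0$ be the unique solution of $\int_{-\infty}^{\infty}W'(x-c_0)f(x)\,dx=0$, and for $u>0$ let $m(\boldsymbol0,u)$ be the median of the conditional distribution of $X_{(2)}-\theta_{(2)}$ given $U=u$ when $\boldsymbol\theta=\boldsymbol0=(0,0)$. If $P_{\boldsymbol\theta}(m(\boldsymbol0,U)<c_0)\ne0$ for some $\boldsymbol\theta\in\mathbb{R}^2$, then, under the generalized Pitman nearness criterion with loss $W(a-\theta_{(2)})$, the estimator $$\delta^*_{PN}(\mathbf X)=X_{(2)}-\min\{c_0,m(\boldsymbol0,U)\}$$ is Pitman nearer to $\theta_{(2)}$ than the usual estimator $\delta_{c_0}(\mathbf X)=X_{(2)}-c_0$; that is, $GPN(\delta^*_{PN},\delta_{c_0};\boldsymbol\theta)\ge\frac12$ for all $\boldsymbol\theta\in\mathbb{R}^2$, with strict inequality for some $\boldsymbol\theta$.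
   Context: Setting: $f$ is a Lebesgue probability density on $\mathbb{R}$; $X_1,X_2$ are independent and $X_i$ has density $x\mapsto f(x-\theta_i)$, where $\boldsymbol\theta=(\theta_1,\theta_2)\in\mathbb{R}^2$ is unknown. Write $\theta_{(1)}=\min\{\theta_1,\theta_2\}$, $\theta_{(2)}=\max\{\theta_1,\theta_2\}$, $X_{(1)}=\min\{X_1,X_2\}$, $X_{(2)}=\max\{X_1,X_2\}$, $U=X_{(2)}-X_{(1)}$, $\mathbf X=(X_1,X_2)$. With $\theta=\theta_{(2)}-\theta_{(1)}\ge0$, the conditional distribution of $X_{(2)}-\theta_{(2)}$ given $U=u>0$ has density proportional to $z\mapsto f(z-u+\theta)f(z)+f(z-u)f(z+\theta)$; implicitly it is well defined and has a unique median. For $\boldsymbol\theta=\boldsymbol0$ the density is proportional to $f(z-u)f(z)$. Generalized Pitman nearness: for estimators $\delta_1,\delta_2$ of $\theta_{(2)}$ and loss $L(\boldsymbol\theta,a)=W(a-\theta_{(2)})$, $GPN(\delta_1,\delta_2;\boldsymbol\theta)=P_{\boldsymbol\theta}[L(\boldsymbol\theta,\delta_1)<L(\boldsymbol\theta,\delta_2)]+\frac12P_{\boldsymbol\theta}[L(\boldsymbol\theta,\delta_1)=L(\boldsymbol\theta,\delta_2)]$. Conditions on $W:\mathbb{R}\to[0,\infty)$: (C1) $W(0)=0$, $W$ is strictly decreasing on $(-\infty,0)$ and strictly increasing on $(0,\infty)$; (C2) $W'$ is increasing almost everywhere; (C3) the integrals involving $W$ are finite and differentiation under the integral sign is permissible.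 *)

(* Defs.v *)
From mathcomp Require Import all_boot all_order all_algebra.
From mathcomp Require Import all_classical all_reals all_analysis.

Set Implicit Arguments.
Unset Strict Implicit.
Unset Printing Implicit Defensive.

Import Order.TTheory GRing.Theory Num.Theory.
Import numFieldNormedType.Exports.

Local Open Scope classical_set_scope.
Local Open Scope ring_scope.

Definition prob_density (R : realType) (f : R -> R) : Prop :=
  [/\ measurable_fun setT f,
      forall x, 0 <= f x &
      (\int[@lebesgue_measure R]_x (f x)%:E = 1)%E].

Definition MLR (R : realType) (f : R -> R) : Prop :=
  forall x1 x2 eta1 eta2 : R, x1 < x2 -> eta1 < eta2 ->
    f (x1 - eta2) * f (x2 - eta1) <= f (x1 - eta1) * f (x2 - eta2).

Section model.
Context d (T : measurableType d) (R : realType).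

Definition has_density (P : probability T R) (X : T -> R) (g : R -> R) : Prop :=
  forall A : set R, measurable A ->
    P (X @^-1` A) = (\int[@lebesgue_measure R]_(x in A) (g x)%:E)%E.

Definition independent_rv (P : probability T R) (X Y : T -> R) : Prop :=
  forall A B : set R, measurable A -> measurable B ->
    P (X @^-1` A `&` Y @^-1` B) = (P (X @^-1` A) * P (Y @^-1` B))%E.

Definition location_model (f : R -> R) (P : R * R -> probability T R)
    (X1 X2 : T -> R) : Prop :=
  forall theta : R * R,
    [/\ has_density (P theta) X1 (fun x => f (x - theta.1)),
        has_density (P theta) X2 (fun x => f (x - theta.2)) &
        independent_rv (P theta) X1 X2].

End model.

Section conditional_median.
Context (R : realType).
Implicit Types (f g : R -> R) (theta u z m : R).

(* Up to normalization, the density at z of X_(2) - theta_(2) given U = u,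
   where theta = theta_(2) - theta_(1); obtained from the joint density of
   (X_1, X_2) by the change of variables (X_1, X_2) -> (X_(2) - theta_(2), U). *)
Definition cond_kernel f theta u z : R :=
  f (z - u + theta) * f z + f (z - u) * f (z + theta).

Definition normalizable g : Prop :=
  (@lebesgue_measure R).-integrable setT (EFin \o g) /\
  0 < \int[@lebesgue_measure R]_z g z.

Definition normalize_density g z : R :=
  g z / \int[@lebesgue_measure R]_y g y.

Definition is_median g m : Prop :=
  2^-1 <= \int[@lebesgue_measure R]_(z in `]-oo, m]) g z /\
  2^-1 <= \int[@lebesgue_measure R]_(z in `[m, +oo[) g z.

Definition is_unique_median g m : Prop :=
  is_median g m /\ forall m', is_median g m' -> m' = m.

(* The conditional law given U = u is a probability law, with unique median m. *)
Definition is_cond_median f theta u m : Prop :=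
  normalizable (cond_kernel f theta u) /\
  is_unique_median (normalize_density (cond_kernel f theta u)) m.

End conditional_median.

Section loss.
Context (R : realType).
Implicit Types (f W : R -> R) (c : R).

Definition condC1 W : Prop :=
  [/\ W 0 = 0,
      forall x y, x < y -> y < 0 -> W y < W x &
      forall x y, 0 < x -> x < y -> W x < W y].

(* "Increasing" is the weak notion, so that e.g. W = |.| is allowed. *)
Definition condC2 W : Prop :=
  exists2 N : set R, (@lebesgue_measure R).-negligible N &
    (forall x, ~ N x -> derivable W x 1) /\
    (forall x y, ~ N x -> ~ N y -> x <= y -> derive1 W x <= derive1 W y).

(* derive1 W has the junk value 0 on the null set where W is not derivable. *)
Definition condC3 W f : Prop :=
  forall c,
    [/\ (@lebesgue_measure R).-integrable setT
          (EFin \o (fun x => W (x - c) * f x)),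
        (@lebesgue_measure R).-integrable setT
          (EFin \o (fun x => derive1 W (x - c) * f x)) &
        is_derive c 1
          (fun b => \int[@lebesgue_measure R]_x (W (x - b) * f x))
          (- \int[@lebesgue_measure R]_x (derive1 W (x - c) * f x))].

Definition score W f c : R :=
  \int[@lebesgue_measure R]_x (derive1 W (x - c) * f x).

End loss.

Section pitman.
Context d (T : measurableType d) (R : realType).
Implicit Types (W : R -> R) (theta : R * R) (delta : R * R -> R).

Definition loss W theta (a : R) : R := W (a - Num.max theta.1 theta.2).

Definition GPN (P : R * R -> probability T R) (X : T -> R * R) W
    delta1 delta2 theta : \bar R :=
  (P theta [set w | (loss W theta (delta1 (X w))
                     < loss W theta (delta2 (X w)))%R]
   + (2^-1)%:E *
     P theta [set w | loss W theta (delta1 (X w))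
                      = loss W theta (delta2 (X w))])%E.

Definition pitman_nearer (P : R * R -> probability T R) (X : T -> R * R) W
    delta1 delta2 : Prop :=
  (forall theta, ((2^-1)%:E <= GPN P X W delta1 delta2 theta)%E) /\
  (exists theta, ((2^-1)%:E < GPN P X W delta1 delta2 theta)%E).

End pitman.

Section estimators.
Context (R : realType).
Implicit Types (x : R * R) (c : R) (m : R -> R).

Definition range2 x : R := Num.max x.1 x.2 - Num.min x.1 x.2.

Definition delta_usual c x : R := Num.max x.1 x.2 - c.

Definition delta_PN c m x : R := Num.max x.1 x.2 - Num.min c (m (range2 x)).

End estimators.

(* Main.v *)
(* Write Z = X_(2) - theta_(2), U = X_(2) - X_(1), t = |theta_1 - theta_2|, and
   k_t(u, .) for the kernel of Z given U = u.  On {m(U) < c0} the new estimator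
   has the smaller loss as soon as Z <= m(U), and off this event the losses are
   equal, so it suffices that P(Z <= m(u) | U = u) >= 1/2.  MLR makes k_t / k_0
   nonincreasing, hence Z is stochastically smaller under t than under 0, where
   m(u) is the median.

   Strictness at small t > 0: if the two half masses of k_t agreed, then k_t and
   k_0 would be proportional a.e.  But f(z + t) > f(z) and f(z + t) < f(z) both
   hold on sets of positive measure (otherwise f would be t-periodic), and the
   support of f is an unbounded interval since k_0(u, .) is nonzero for all
   u > 0; together these make the monotonicity of k_t / k_0 strict somewhere. *)

From HB Require Import structures.
Require Import Defs.
From mathcomp Require Import all_boot all_order all_algebra.
From mathcomp Require Import all_classical all_reals all_analysis.
From mathcomp Require Import measurable_realfun.
From mathcomp Require Import ring lra.

Set Implicit Arguments.
Unset Strict Implicit.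
Unset Printing Implicit Defensive.

Import Order.TTheory GRing.Theory Num.Theory.
Import numFieldNormedType.Exports.

Local Open Scope classical_set_scope.
Local Open Scope ring_scope.

(** * Translation and reflection of Lebesgue integrals, and a planar change of variables *)

Section lebesgue_change_of_variables.
Context {R : realType}.
Local Notation mu := (@lebesgue_measure R).
Local Notation GR := (measurableTypeR R).
Local Open Scope ereal_scope.

Lemma lebesgue_measure_shift (c : R) (A : set R) : measurable A ->
  pushforward mu ((fun x => x + c)%R : _ -> measurableTypeR R) A = mu A.
Proof.
move=> mA; apply/esym/lebesgue_measure_unique => //=.
  exact: measurable_funD.
move=> _ _ [[a b]] _ <-; rewrite /pushforward.
have -> : ((fun x => x + c)%R @^-1` `]a, b]%classic = `]a - c, b - c]%classic)%R.
  by apply/seteqP; split=> x /=; rewrite !in_itv/= ltrBlDr lerBrDr.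
rewrite !lebesgue_measure_itv/= !lte_fin ltrD2r; case: ifP => // _.
by rewrite -!EFinB; congr EFin; ring.
Qed.

Lemma ge0_integral_shift (c : R) (f : GR -> \bar R) :
  measurable_fun setT f -> (forall x, 0 <= f x) ->
  \int[mu]_x f (x + c)%R = \int[mu]_x f x.
Proof.
move=> mf f0.
have mc : measurable_fun setT ((fun x => x + c)%R : GR -> GR).
  exact: measurable_funD.
have := @ge0_integral_pushforward _ _ (measurableTypeR R) (measurableTypeR R) R
  _ mc (@lebesgue_measure R) _ _ measurableT mf (fun x _ => f0 x).
rewrite preimage_setT => <-; apply: eq_measure_integral => /= A mA _.
exact: lebesgue_measure_shift.
Qed.

Lemma ge0_integralN (f : GR -> \bar R) :
  measurable_fun setT f -> (forall x, 0 <= f x) ->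
  \int[mu]_x f (- x)%R = \int[mu]_x f x.
Proof.
move=> mf f0.
have mN : measurable_fun setT (-%R : measurableTypeR R -> measurableTypeR R) by [].
have := @ge0_integral_pushforward _ _ (measurableTypeR R) (measurableTypeR R) R
  _ mN (@lebesgue_measure R) _ _ measurableT mf (fun x _ => f0 x).
rewrite preimage_setT => <-; apply: eq_measure_integral => /= A mA _.
exact: lebesgue_measureN.
Qed.

Lemma negligible_shift (c : R) (N : set R) : mu.-negligible N ->
  mu.-negligible [set x | N (x + c)%R].
Proof.
move=> [A [mA A0 NA]]; exists ((fun x => x + c)%R @^-1` A); split.
- by rewrite -[X in measurable X]setTI; exact: measurable_funD.
- by rewrite -[LHS]/(pushforward mu _ A) lebesgue_measure_shift.
- by move=> x /NA.
Qed.

(** The substitution x = z + M - u, y = z + M, done one variable at a time: by Tonelli, y is fixed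
    first and x replaced by y - u (a shift and a reflection), then y is shifted by M. Here u plays
    the range and z the centred maximum. *)
Lemma ge0_integral_max_range (M : R) (f : GR * GR -> \bar R) :
  measurable_fun setT f -> (forall p, 0 <= f p) ->
  \int[mu]_x \int[mu]_y f (x, y) =
  \int[mu]_u \int[mu]_z f (z + M - u, z + M)%R.
Proof.
move=> mf f0; rewrite (fubini_tonelli f mf f0).
pose G y := \int[mu]_u f (y - u, y)%R.
have GE y : \int[mu]_x f (x, y) = G y.
  have mfy : measurable_fun setT (fun x => f (x, y)).
    exact: measurableT_comp mf (pair2_measurable _).
  rewrite -(ge0_integral_shift y)// -ge0_integralN//=.
    by apply: eq_integral => u _; rewrite addrC.
  exact: measurableT_comp mfy (measurable_funD _ _).
have mG : measurable_fun setT G.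
  apply: (eq_measurable_fun (fun y => \int[mu]_x f (x, y))) => //.
  exact: measurable_fun_fubini_tonelli_G.
transitivity (\int[mu]_z G (z + M)%R).
  rewrite (ge0_integral_shift M mG); last by move=> x; exact: integral_ge0.
  by apply: eq_integral => y _; exact: GE.
rewrite /G (fubini_tonelli
  (fun p : GR * GR => f (p.1 + M - p.2, p.1 + M)%R))//.
apply: measurableT_comp mf _; apply: measurable_fun_pair.
  by apply: measurable_funB => //; exact: measurable_funD.
exact: measurable_funD.
Qed.

End lebesgue_change_of_variables.

(** * Joint law of two independent variables with densities *)

Section joint_density.
Local Open Scope ereal_scope.

Lemma ge0_integral_sigma_additive d (T : measurableType d) (R : realType)
    (mu : {measure set T -> \bar R}) (h : T -> \bar R) :
  measurable_fun setT h -> (forall x, 0 <= h x) ->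
  semi_sigma_additive (fun A => \int[mu]_(x in A) h x).
Proof.
move=> mh h0 F mF tF mUF; rewrite ge0_integral_bigcup//; last first.
  exact: measurable_funS mh.
by apply: is_cvg_ereal_nneg_natsum => k _; exact: integral_ge0.
Qed.

(** The measure [nu] with density g(x)h(y) and the law of (X, Y) agree on rectangles with the
    product of the marginal laws; uniqueness of the product measure identifies both with it. *)
Lemma independent_joint_density d (T : measurableType d) (R : realType)
    (GR := measurableTypeR R)
    (P : probability T R) (X Y : {mfun T >-> R}) (g h : R -> R) :
  measurable_fun setT g -> measurable_fun setT h ->
  (forall x, 0 <= g x)%R -> (forall x, 0 <= h x)%R ->
  has_density P X g -> has_density P Y h -> independent_rv P X Y ->
  forall B : set (GR * GR), measurable B ->
  P [set w | B (X w, Y w)] =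
  \int[@lebesgue_measure R]_x \int[@lebesgue_measure R]_y
    (\1_B (x, y) * g x * h y)%:E.
Proof.
move=> mg mh g0 h0 Xg Yh XY B mB.
pose mu := @lebesgue_measure R.
pose gh (p : GR * GR) := (g p.1 * h p.2)%:E.
have mgh : measurable_fun setT gh.
  apply/measurable_EFinP/measurable_funM.
    exact: measurableT_comp mg measurable_fst.
  exact: measurableT_comp mh measurable_snd.
have gh0 p : 0 <= gh p by rewrite lee_fin mulr_ge0.
pose nu (A : set (GR * GR)) := \int[mu \x mu]_(p in A) gh p.
have nu0 : nu set0 = 0 by exact: integral_set0.
have nu_ge0 A : 0 <= nu A by exact: integral_ge0.
have nu_additive : semi_sigma_additive nu.
  exact: (@ge0_integral_sigma_additive _ _ _ (mu \x mu) gh mgh gh0).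
pose nuM : {measure set (GR * GR) -> \bar R} := HB.pack nu
  (isMeasure.Build _ _ _ nu nu0 nu_ge0 nu_additive).
have mXR : measurable_fun setT X by [].
have mX : measurable_fun setT (X : T -> GR) by exact: mXR.
have mYR : measurable_fun setT Y by [].
have mY : measurable_fun setT (Y : T -> GR) by exact: mYR.
(* [X'] and [Y'] are [X] and [Y] with the codomain retyped to the space carrying Lebesgue
   measure. *)
pose X' : {mfun T >-> GR} := HB.pack (X : T -> GR)
  (isMeasurableFun.Build _ _ _ _ _ mX).
pose Y' : {mfun T >-> GR} := HB.pack (Y : T -> GR)
  (isMeasurableFun.Build _ _ _ _ _ mY).
have mXY : measurable_fun setT (fun w => (X' w, Y' w)).
  exact: measurable_fun_pair.
have nuE A : measurable A -> nu A =
    \int[mu]_x \int[mu]_y (\1_A (x, y) * g x * h y)%:E.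
  move=> mA; rewrite /nu integral_mkcond.
  have mr : measurable_fun setT (gh \_ A).
    exact/(measurable_restrictT gh mA)/measurable_funTS.
  have r0 p : 0 <= (gh \_ A) p by apply: erestrict_ge0.
  rewrite (fubini_tonelli1 _ mr r0).
  rewrite /fubini_F; apply: eq_integral => x _; apply: eq_integral => y _.
  rewrite patchE indicE; case: ifPn => _; first by rewrite mul1r.
  by rewrite !mul0r.
have nu_rect A C : measurable A -> measurable C ->
    nu (A `*` C) = distribution P X' A * distribution P Y' C.
  move=> mA mC; rewrite nuE; last exact: measurableX.
  rewrite /distribution /pushforward Xg// Yh//.
  rewrite [in RHS]integral_mkcond [X in _ * X]integral_mkcond.
  rewrite -ge0_integralZr//; last 3 first.
  - apply/(measurable_restrictT _ _).1 => //.
    exact/measurable_funTS/measurable_EFinP.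
  - by move=> x _; apply: erestrict_ge0 => t _; rewrite lee_fin.
  - by apply: integral_ge0 => x _; apply: erestrict_ge0 => t _; rewrite lee_fin.
  apply: eq_integral => x _; rewrite -ge0_integralZl//; last 3 first.
  - apply/(measurable_restrictT _ _).1 => //.
    exact/measurable_funTS/measurable_EFinP.
  - by move=> y _; apply: erestrict_ge0 => t _; rewrite lee_fin.
  - by apply: erestrict_ge0 => t _; rewrite lee_fin.
  apply: eq_integral => y _; rewrite !patchE indicE in_setX/=.
  by case: (x \in A); case: (y \in C);
    rewrite /= ?(mul1r, mul0r, mule0, mul0e)// EFinM.
rewrite -nuE// -[RHS]/(nuM B).
rewrite -(product_measure_unique (m1 := distribution P X')
  (m2 := distribution P Y'))//.
rewrite (product_measure_unique (m' := pushforward P (fun w => (X' w, Y' w))))//.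
Qed.

End joint_density.

(** * Ordered functions with equal finite integrals agree almost everywhere *)

Section ae_equality.
Context d (T : measurableType d) (R : realType) (mu : {measure set T -> \bar R}).
Local Open Scope ereal_scope.

Lemma lee_add_eq (a b c e : \bar R) : 0 <= a -> 0 <= c -> a <= b -> c <= e ->
  b + e = a + c -> b + e < +oo -> b = a.
Proof.
move=> a0 c0 ab ce eq lty.
have b0 := le_trans a0 ab; have e0 := le_trans c0 ce.
have bfin : b \is a fin_num.
  by rewrite ge0_fin_numE// (le_lt_trans _ lty)// leeDl.
have efin : e \is a fin_num.
  by rewrite ge0_fin_numE// (le_lt_trans _ lty)// leeDr.
have afin : a \is a fin_num.
  by rewrite ge0_fin_numE// (le_lt_trans ab)// -ge0_fin_numE.
have cfin : c \is a fin_num.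
  by rewrite ge0_fin_numE// (le_lt_trans ce)// -ge0_fin_numE.
move: a b c e afin bfin cfin efin {a0 c0 b0 e0 lty} ab ce eq.
move=> [a| |] [b| |] [c| |] [e| |]//= _ _ _ _; rewrite !lee_fin => ab ce [] eq.
by congr EFin; lra.
Qed.

(** For measurable E in D, the inequalities between the integrals over E and over D \ E add up to an
    equality of finite numbers, so each is an equality by [lee_add_eq]; integrals agreeing on every
    such E give equality a.e. *)
Lemma ge0_le_integral_ae_eq (D : set T) (g h : T -> \bar R) :
  measurable D -> measurable_fun D g -> measurable_fun D h ->
  (forall x, D x -> 0 <= g x) -> (forall x, D x -> 0 <= h x) ->
  (\forall x \ae mu, D x -> g x <= h x) ->
  \int[mu]_(x in D) h x <= \int[mu]_(x in D) g x ->
  \int[mu]_(x in D) h x < +oo -> ae_eq mu D h g.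
Proof.
move=> mD mg mh g0 h0 gh int_hg int_h.
apply: integral_ae_eq => //.
  apply/integrableP; split=> //.
  by under eq_integral => x /[!inE] Dx do rewrite gee0_abs ?h0//.
move=> E ED mE; have mDE : measurable (D `\` E) by exact: measurableD.
have split_int f : measurable_fun D f -> (forall x, D x -> 0 <= f x) ->
    \int[mu]_(x in E) f x + \int[mu]_(x in D `\` E) f x = \int[mu]_(x in D) f x.
  move=> mf f0; rewrite -ge0_integral_setU//; first by rewrite setDUK.
  - by rewrite setDUK.
  - by rewrite setDUK.
  - exact/disj_set2P/setDIK.
have sDE : D `\` E `<=` D by move=> x [].
have E0 f : (forall x, D x -> 0 <= f x) -> 0 <= \int[mu]_(x in E) f x.
  by move=> f0; apply: integral_ge0 => x /ED /f0.
have DE0 f : (forall x, D x -> 0 <= f x) -> 0 <= \int[mu]_(x in D `\` E) f x.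
  by move=> f0; apply: integral_ge0 => x /sDE /f0.
apply: (@lee_add_eq _ _ (\int[mu]_(x in D `\` E) g x)
  (\int[mu]_(x in D `\` E) h x)); rewrite ?E0 ?DE0//.
- apply: ae_ge0_le_integral => //.
  + by move=> x /ED /g0.
  + exact: measurable_funS mg.
  + by move=> x /ED /h0.
  + exact: measurable_funS mh.
  + by apply: filterS gh => x + /ED.
- apply: ae_ge0_le_integral => //.
  + by move=> x /sDE /g0.
  + exact: measurable_funS mg.
  + by move=> x /sDE /h0.
  + exact: measurable_funS mh.
  + by apply: filterS gh => x + /sDE.
- rewrite !split_int//; apply/eqP; rewrite eq_le int_hg/=.
  exact: ae_ge0_le_integral.
- by rewrite split_int.
Qed.

End ae_equality.

(** * Consequences of MLR for the density and the conditional kernel *)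

Section conditional_kernel.
Context {R : realType}.
Variable f : R -> R.
Hypotheses (f_density : prob_density f) (f_MLR : MLR f).
Local Notation mu := (@lebesgue_measure R).
Local Notation k := (cond_kernel f).

Let mf : measurable_fun setT f. Proof. by case: f_density. Qed.
Let f0 x : 0 <= f x. Proof. by case: f_density. Qed.

(** MLR at the points a + t, b + t with parameters 0, t: the ratio f(x + t)/f(x) is nonincreasing in
    x, in cross-multiplied form so that zeros of f cause no trouble. *)
Lemma MLR_shift (a b t : R) : a <= b -> 0 <= t -> f a * f (b + t) <= f (a + t) * f b.
Proof.
rewrite le_eqVlt => /predU1P[->|ab]; first by rewrite mulrC.
rewrite le_eqVlt => /predU1P[<-|t0]; first by rewrite !addr0.
have abt : a + t < b + t by rewrite ltrD2r.
by have := f_MLR abt t0; rewrite !subr0 !addrK.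
Qed.

(** Shifting by y - x gives f(x)f(z) <= f(y)f(x + z - y), so f(y) cannot vanish: the support is an
    interval. *)
Lemma MLR_interval (x y z : R) : x <= y -> y <= z -> 0 < f x -> 0 < f z -> 0 < f y.
Proof.
move=> xy yz fx fz.
have := @MLR_shift x (x + z - y) (y - x); rewrite subr_ge0 xy.
have -> : x + z - y + (y - x) = z by ring.
have -> : x + (y - x) = y by ring.
have -> : x <= x + z - y by lra.
move=> /(_ isT isT) /(lt_le_trans (mulr_gt0 fx fz)) h.
by rewrite lt_neqAle f0 andbT; apply: contraTneq h => <-; rewrite mul0r ltxx.
Qed.

Lemma cond_kernel_ge0 (t u z : R) : 0 <= k t u z.
Proof. by rewrite addr_ge0// mulr_ge0. Qed.

Lemma measurable_cond_kernel (t u : R) : measurable_fun setT (k t u).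
Proof.
apply: measurable_funD; apply: measurable_funM => //;
  apply: measurableT_comp mf _; apply: measurable_funD => //.
exact: measurable_funD.
Qed.

(** Since k_0(u, z) = 2f(z - u)f(z), the claim is twice the sum of two shift inequalities, at z - u
    <= z' - u with weight f(z)f(z') and at z <= z' with weight f(z - u)f(z' - u). *)
Lemma cond_kernel_TP2 (t u z z' : R) : 0 <= t -> z <= z' ->
  k t u z' * k 0 u z <= k t u z * k 0 u z'.
Proof.
move=> t0 zz'; rewrite /cond_kernel !addr0.
have H1 : f (z - u) * f (z' - u + t) <= f (z - u + t) * f (z' - u).
  by apply: MLR_shift => //; rewrite lerD2r.
have H2 := MLR_shift zz' t0.
have := ler_wpM2l (mulr_ge0 (f0 z) (f0 z')) H1.
have := ler_wpM2l (mulr_ge0 (f0 (z - u)) (f0 (z' - u))) H2.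
nra.
Qed.

Local Open Scope ereal_scope.

(** Both sides integrate to 1, so f(z + c) <= f(z) a.e. would force equality a.e. The distribution
    function [F] would then be c-periodic, hence identically 1 by its limit at +oo, which leaves no
    mass in any upper tail. *)
Lemma not_ae_shift_le (c : R) : c != 0%R ->
  ~ mu.-negligible [set z | ~ (f (z + c) <= f z)%R].
Proof.
move=> c0 f_ae.
have mEf : measurable_fun setT (EFin \o f : measurableTypeR R -> \bar R).
  exact/measurable_EFinP.
have mfc (e : R) :
    measurable_fun setT (fun z : measurableTypeR R => (f (z + e)%R)%:E).
  apply: (measurableT_comp mEf).
  exact: measurable_funD.
have Ef0 x : 0 <= (f x)%:E by rewrite lee_fin.
have [_ _ intf] := f_density.
have shift_eq : ae_eq mu setT (EFin \o f) (fun z => (f (z + c)%R)%:E).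
  apply: ge0_le_integral_ae_eq => //.
  - by move=> z _; exact: Ef0.
  - case: f_ae => N [mN N0 fN]; exists N; split=> // z H.
    by apply: fN => /= fz; apply: H => _; rewrite lee_fin.
  - by rewrite (ge0_integral_shift c mEf Ef0).
  - by rewrite intf ltry.
pose F x := \int[mu]_(z in `]-oo, x]) (f z)%:E.
have Fc x : F (x + c)%R = F x.
  have mI : measurable (`]-oo, (x + c)%R] : set (measurableTypeR R)).
    exact: measurable_itv.
  rewrite /F integral_mkcond -(ge0_integral_shift c); last 2 first.
  - exact: ((measurable_restrictT (EFin \o f) mI).1 (measurable_funTS mEf)).
  - by move=> z; apply: erestrict_ge0.
  have mJ : measurable (`]-oo, x]%classic : set (measurableTypeR R)).
    exact: measurable_itv.
  rewrite [RHS](ae_eq_integral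
    (fun z : measurableTypeR R => (f (z + c)%R)%:E) _ mJ (measurable_funTS mEf)
    (measurable_funTS (mfc c)) (ae_eq_subset (@subsetT _ _) shift_eq)).
  rewrite [RHS]integral_mkcond; apply: eq_integral => z _.
  by rewrite !patchE !mem_setE !in_itv/= lerD2r.
(* The absolute value makes the iterated shift go to +oo whatever the sign of [c]. *)
have Fn x n : F (x + n%:R * `|c|)%R = F x.
  have Fabs y : F (y + `|c|)%R = F y.
    have [c_ge0|c_lt0] := leP 0%R c; first by rewrite ger0_norm.
    by rewrite ltr0_norm// -[LHS]Fc subrK.
  elim: n x => [|n IH] x; first by rewrite mul0r addr0.
  by rewrite -natr1 mulrDl mul1r addrA Fabs IH.
have absc : (0 < `|c|)%R by rewrite normr_gt0.
have tail_cvg x : exists n, (x < n%:R * `|c|)%R.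
  exists (Num.truncn (`|x| / `|c|)).+1; rewrite (le_lt_trans (ler_norm x))//.
  by rewrite -ltr_pdivrMr// Num.Theory.truncnS_gt.
have F1 x : F x = 1.
  have := @ge0_nondecreasing_set_cvg_integral _ _ R
    (fun n => `]-oo, (x + n%:R * `|c|)%R]%classic : set (measurableTypeR R))
    (EFin \o f) mu.
  have -> : \bigcup_i `]-oo, (x + i%:R * `|c|)%R]%classic = [set: R].
    apply/seteqP; split=> // z _; have [n zn] := tail_cvg (z - x)%R.
    by exists n => //=; rewrite in_itv/= ltW// -ltrBlDl.
  rewrite intf => cvgF; apply/esym.
  have /cvg_lim <- // : F (x + n%:R * `|c|)%R @[n --> \oo] --> 1.
    apply: cvgF => //.
    - apply/nondecreasing_seqP => n; apply/subsetPset => z /=.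
      rewrite !in_itv/= => /le_trans; apply.
      by rewrite lerD2l ler_wpM2r// ler_nat.
    - by move=> n; exact: measurable_funTS mEf.
    - by move=> n z _; exact: Ef0.
  by under eq_fun do rewrite Fn; exact: lim_cst.
have G0 x : \int[mu]_(z in `]x, +oo[) (f z)%:E = 0.
  have : F x + \int[mu]_(z in `]x, +oo[) (f z)%:E = 1.
    rewrite /F -ge0_integral_setU//; last 2 first.
    - exact: measurable_funTS mEf.
    - by apply/disj_set2P/seteqP; split=> // z /=; rewrite !in_itv/=; lra.
    rewrite -intf; congr (integral _ _ _); apply/seteqP; split=> // z _ /=.
    by rewrite !in_itv/= andbT; have [?|?] := leP z x; [left|right].
  rewrite F1; move: (\int[mu]_(z in _) _) => [r| |]//= [] r0.
  by congr EFin; lra.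
(* The tails ]-n|c|, +oo[ exhaust the line, so their null masses would converge to the total mass
   1. *)
have := @ge0_nondecreasing_set_cvg_integral _ _ R
  (fun n => `](- (n%:R * `|c|))%R, +oo[%classic : set (measurableTypeR R))
  (EFin \o f) mu.
have -> : \bigcup_i `](- (i%:R * `|c|))%R, +oo[%classic = [set: R].
  apply/seteqP; split=> // z _; have [n zn] := tail_cvg (- z)%R.
  by exists n => //=; rewrite in_itv/= andbT ltrNl.
rewrite intf => cvgG.
have /cvg_lim lim1 : \int[mu]_(z in `](- (n%:R * `|c|))%R, +oo[) (f z)%:E
    @[n --> \oo] --> 1.
  apply: cvgG => //.
  - apply/nondecreasing_seqP => n; apply/subsetPset => z /=.
    rewrite !in_itv/= !andbT; apply: le_lt_trans.
    by rewrite lerN2 ler_wpM2r// ler_nat.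
  - by move=> n; exact: measurable_funTS mEf.
  - by move=> n z _; exact: Ef0.
have : (0 : \bar R) = 1.
  rewrite -[RHS]lim1//; under [in RHS]eq_fun do rewrite G0.
  by apply/esym; exact: lim_cst.
by move=> [] /esym/eqP; rewrite oner_eq0.
Qed.

(** Used with c = t and c = -t to find, off a null set, a point where f rises and a point where f
    falls under the shift by t. *)
Lemma ex_lt_shift (c : R) (N : set R) : c != 0%R -> mu.-negligible N ->
  exists2 z, ~ N z & (f z < f (z + c))%R.
Proof.
move=> c0 Nnull; apply: contrapT => H; apply: (not_ae_shift_le c0).
apply: negligibleS Nnull => z /= /negP; rewrite -ltNge => fz.
by apply: contrapT => Nz; apply: H; exists z.
Qed.

Section support.
Hypothesis f_supp :
  forall u : R, (0 < u)%R -> exists2 z, (0 < f (z - u))%R & (0 < f z)%R.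

(** If the support lay strictly between a and b, no two of its points could be max(b - a, 1) apart;
    the 1 keeps this lag positive. *)
Lemma support_unbounded :
  (forall x, exists2 y, (y <= x)%R & (0 < f y)%R) \/
  (forall x, exists2 y, (x <= y)%R & (0 < f y)%R).
Proof.
apply: contrapT => /not_orP[/existsNP[a fa] /existsNP[b fb]].
have u0 : (0 < Num.max (b - a) 1)%R by rewrite lt_max ltr01 orbT.
have [z fzu fz] := f_supp u0.
have az : (a < z - Num.max (b - a) 1)%R.
  by rewrite ltNge; apply/negP => za; apply: fa; exists (z - Num.max (b - a) 1)%R.
have zb : (z < b)%R by rewrite ltNge; apply/negP => zb; apply: fb; exists z.
have : (b - a <= Num.max (b - a) 1)%R by rewrite le_max lexx.
lra.
Qed.

End support.

(** * Half masses of k_t on the two sides of the median of k_0 *)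

Section median_comparison.
Variables (t u m : R).
Local Notation lower := (`]-oo, m]%classic : set R).
Local Notation upper := (`]m, +oo[%classic : set R).
Local Notation K D t := (\int[mu]_(z in D) (k t u z)%:E).
Hypotheses (t0 : (0 <= t)%R) (half : K lower 0 = K upper 0).
Hypotheses (K0 : 0 < K lower 0) (Koo : K lower 0 < +oo).

Let mk e D : measurable_fun (D : set (measurableTypeR R))
  (fun z : measurableTypeR R => (k e u z)%:E).
Proof.
apply: measurable_funTS; apply/measurable_EFinP; exact: measurable_cond_kernel.
Qed.

Let k0 e z : 0 <= (k e u z)%:E.
Proof. by rewrite lee_fin cond_kernel_ge0. Qed.

(** [cond_kernel_TP2] with the lower point z fixed, integrated over the upper half; [upperP] is its
    mirror image. *)
Let lowerP z : lower z -> (k t u z)%:E * K upper 0 >= K upper t * (k 0 u z)%:E.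
Proof.
rewrite /= in_itv/= => zm.
rewrite -ge0_integralZl// -ge0_integralZr//.
apply: ge0_le_integral => //.
- by move=> z' _; rewrite mule_ge0.
- exact: emeasurable_funM.
- exact: emeasurable_funM.
move=> z'; rewrite /= in_itv/= andbT => mz'; rewrite -!EFinM lee_fin.
by apply: cond_kernel_TP2 => //; rewrite (le_trans zm)// ltW.
Qed.

Let upperP z : upper z -> (k t u z)%:E * K lower 0 <= K lower t * (k 0 u z)%:E.
Proof.
rewrite /= in_itv/= andbT => mz.
rewrite -ge0_integralZl// -ge0_integralZr//.
apply: ge0_le_integral => //.
- by move=> z' _; rewrite mule_ge0.
- exact: emeasurable_funM.
- exact: emeasurable_funM.
move=> z'; rewrite /= in_itv/= => z'm; rewrite -!EFinM lee_fin.
by apply: cond_kernel_TP2 => //; rewrite (le_trans z'm)// ltW.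
Qed.

(** Integrating [upperP] over the upper half gives K upper t * K lower 0 <= K lower t * K upper 0,
    and the two masses of k_0 are equal, positive and finite. *)
Lemma upper_le_lower : K upper t <= K lower t.
Proof.
have Kfin : K lower 0 \is a fin_num by rewrite ge0_fin_numE// ltW.
rewrite -(@lee_pmul2r _ (K lower 0))//.
have -> : K upper t * K lower 0 =
    \int[mu]_(z in upper) ((k t u z)%:E * K lower 0).
  by rewrite ge0_integralZr// ltW.
have -> : K lower t * K lower 0 =
    \int[mu]_(z in upper) (K lower t * (k 0 u z)%:E).
  by rewrite [in LHS]half ge0_integralZl//; exact: integral_ge0.
apply: ge0_le_integral => //.
- by move=> z _; rewrite mule_ge0// ltW.
- exact: emeasurable_funM.
- exact: emeasurable_funM.
Qed.

Lemma upper_lt_lower : (0 < t <= u)%R ->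
  (forall u : R, (0 < u)%R -> exists2 z, (0 < f (z - u))%R & (0 < f z)%R) ->
  K upper t < +oo -> K upper t < K lower t.
Proof.
move=> /andP[t_gt0 tu] f_supp Ut; rewrite ltNge; apply/negP => LU.
have Kfin : K lower 0 \is a fin_num by rewrite ge0_fin_numE// ltW.
(* Equal half masses turn the integrated forms of [upperP] and [lowerP] into equalities, so both
   hold pointwise a.e. with equality: k_t is a constant multiple of k_0 off a null set [N]. *)
have eqLU : K lower t = K upper t by apply/eqP; rewrite eq_le LU upper_le_lower.
have Ltfin : K lower t \is a fin_num.
  by rewrite ge0_fin_numE ?eqLU//; exact: integral_ge0.
have L0 : 0 <= K lower t by exact: integral_ge0.
have eq_upper : ae_eq mu upper (fun z => K lower t * (k 0 u z)%:E)
    (fun z => (k t u z)%:E * K lower 0).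
  apply: ge0_le_integral_ae_eq => //.
  - exact: emeasurable_funM.
  - exact: emeasurable_funM.
  - by move=> z _; rewrite mule_ge0// ltW.
  - by move=> z _; rewrite mule_ge0.
  - by apply: aeW => z /upperP.
  - by rewrite ge0_integralZl// ge0_integralZr// ?(ltW K0)// -half eqLU.
  - by rewrite ge0_integralZl// -half lte_mul_pinfty.
have eq_lower : ae_eq mu lower (fun z => (k t u z)%:E * K lower 0)
    (fun z => K lower t * (k 0 u z)%:E).
  apply: ge0_le_integral_ae_eq => //.
  - exact: emeasurable_funM.
  - exact: emeasurable_funM.
  - by move=> z _; rewrite mule_ge0.
  - by move=> z _; rewrite mule_ge0// ltW.
  - by apply: aeW => z /lowerP; rewrite eqLU half.
  - by rewrite ge0_integralZl// ge0_integralZr// ltW.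
  - by rewrite ge0_integralZr// ?(ltW K0)// lte_mul_pinfty.
have [N Nnull kE] : exists2 N, mu.-negligible N &
    forall z, ~ N z -> (k t u z * fine (K lower 0) = fine (K lower t) * k 0 u z)%R.
  exists [set z | ~ ((k t u z)%:E * K lower 0 = K lower t * (k 0 u z)%:E)].
    apply: negligibleS (negligibleU eq_upper eq_lower) => z /= kz.
    have [zm|mz] := leP z m.
      by right => /= h; apply: kz; apply: h; rewrite /= in_itv.
    by left => /= h; apply: kz; apply/esym/h; rewrite /= in_itv/= mz.
  move=> z /contrapT; rewrite -[in LHS](fineK Kfin) -[in RHS](fineK Ltfin).
  by rewrite -!EFinM => -[].
have a0 : (0 < fine (K lower 0))%R by rewrite fine_gt0// K0.
(* Proportionality makes [cond_kernel_TP2] an equality at z, z'. Its defect is twice the sum of the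
   nonnegative defects in [P1] and [P2], so both vanish. *)
have kk z z' : ~ N z -> ~ N z' -> (z <= z')%R ->
    (f (z - u) * f (z' - u) * (f (z + t) * f z' - f (z' + t) * f z) = 0 /\
     f z * f z' * (f (z - u + t) * f (z' - u) - f (z' - u + t) * f (z - u)) = 0)%R.
  move=> /kE; set a := fine _ in a0 *; set l := fine _ => kz /kE kz' zz'.
  have H1 : (f (z - u) * f (z' - u + t) <= f (z - u + t) * f (z' - u))%R.
    by apply: MLR_shift => //; rewrite lerD2r.
  have H2 := MLR_shift zz' t0.
  have P1 := ler_wpM2l (mulr_ge0 (f0 z) (f0 z')) H1.
  have P2 := ler_wpM2l (mulr_ge0 (f0 (z - u)) (f0 (z' - u))) H2.
  have E : (k t u z * k 0 u z' = k t u z' * k 0 u z)%R.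
    by apply: (mulIf (lt0r_neq0 a0)); rewrite mulrAC kz [RHS]mulrAC kz' mulrAC.
  move: E P1 P2; rewrite /cond_kernel !addr0 => E P1 P2.
  by split; nra.
have [tneq0 tNneq0] : t != 0%R /\ (- t)%R != 0%R.
  by rewrite oppr_eq0 gt_eqF.
(* A point of rise lies to the left of a point of fall, since the opposite order would contradict
   [MLR_shift]. *)
have ordered z1 z2 : (f z1 < f (z1 + t))%R -> (f (z2 + t) < f z2)%R ->
    (z1 <= z2)%R /\ (0 < f (z1 + t) * f z2 - f (z2 + t) * f z1)%R.
  move=> B1 B2.
  have lt12 : (0 < f (z1 + t) * f z2 - f (z2 + t) * f z1)%R.
    by rewrite subr_gt0 mulrC ltr_pM.
  split => //; rewrite leNgt; apply/negP => z21.
  by have := MLR_shift (ltW z21) t0; move: lt12; lra.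
(* Both summands of [kk] vanish; an unbounded support makes one of them positive. *)
have [left_unb|right_unb] := support_unbounded f_supp.
  have [z1 Nz1 B1] := ex_lt_shift tneq0 Nnull.
  (* The null set is shifted so that it is z2 = x - t, not x, that avoids [N]. *)
  have [x Nx Bx] := ex_lt_shift tNneq0 (negligible_shift (- t) Nnull).
  pose z2 := (x - t)%R.
  have B2 : (f (z2 + t) < f z2)%R by rewrite /z2 subrK.
  have [z12 lt12] := ordered _ _ B1 B2.
  have [E _] := kk _ _ Nz1 Nx z12.
  have f1 : (0 < f (z1 - u))%R.
    have [y yz fy] := left_unb (z1 - u)%R.
    by apply: (MLR_interval yz _ fy (le_lt_trans (f0 _) B1)); lra.
  have f2 : (0 < f (z2 - u))%R.
    have [y yz fy] := left_unb (z2 - u)%R.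
    by apply: (MLR_interval yz _ fy (le_lt_trans (f0 _) B2)); lra.
  by have := mulr_gt0 (mulr_gt0 f1 f2) lt12; rewrite E ltxx.
(* Now [kk] is applied at z1 + u and z2 + u, so that its second identity involves f at z1, z2 and
   their shifts by t. *)
have [z1 Nz1 B1] := ex_lt_shift tneq0 (negligible_shift u Nnull).
have [x Nx Bx] := ex_lt_shift tNneq0
  (negligible_shift (- t) (negligible_shift u Nnull)).
pose z2 := (x - t)%R.
have B2 : (f (z2 + t) < f z2)%R by rewrite /z2 subrK.
have [z12 lt12] := ordered _ _ B1 B2.
have z12u : (z1 + u <= z2 + u)%R by rewrite lerD2r.
have [_] := kk _ _ Nz1 Nx z12u; rewrite !addrK => E.
(* Here t <= u enters: z1 + u lies to the right of the support point z1 + t. *)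
have f1 : (0 < f (z1 + u))%R.
  have [y yz fy] := right_unb (z1 + u)%R.
  by apply: (MLR_interval _ yz (le_lt_trans (f0 _) B1) fy); lra.
have f2 : (0 < f (z2 + u))%R.
  have [y yz fy] := right_unb (z2 + u)%R.
  by apply: (MLR_interval _ yz (le_lt_trans (f0 _) B2) fy); lra.
by have := mulr_gt0 (mulr_gt0 f1 f2) lt12; rewrite E ltxx.
Qed.

End median_comparison.

End conditional_kernel.

(** * The unique median expressed through half masses of the unnormalized density *)

Section median.
Context {R : realType}.
Local Notation mu := (@lebesgue_measure R).
Variables (g : R -> R) (m : R).
Hypotheses (g0 : forall x, 0 <= g x) (g_norm : normalizable g).
Hypothesis m_med : is_unique_median (normalize_density g) m.

Let I := \int[mu]_z g z.
Let lo c := \int[mu]_(z in `]-oo, c]) g z.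
Let up c := \int[mu]_(z in `]c, +oo[) g z.

Let I0 : 0 < I. Proof. by case: g_norm. Qed.

Let gint (D : set R) : measurable D -> mu.-integrable D (EFin \o g).
Proof.
move=> mD; have [gi _] := g_norm.
by apply: integrableS gi => //.
Qed.

Let lo_up c : lo c + up c = I.
Proof.
have cover : `]-oo, c] `|` `]c, +oo[ = [set: R].
  apply/seteqP; split=> // z _ /=.
  by rewrite !in_itv/= andbT; have [?|?] := leP z c; [left|right].
rewrite /lo /up -Rintegral_setU//; first by rewrite cover.
  by rewrite cover; exact: gint.
by apply/disj_set2P/seteqP; split=> // z /=; rewrite !in_itv/=; lra.
Qed.

Let lo_mono c c' : c <= c' -> lo c <= lo c'.
Proof.
move=> cc'.
have sub : `]-oo, c]%classic `<=` (`]-oo, c']%classic : set R).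
  by move=> z /=; rewrite !in_itv/= => /le_trans; apply.
have fin b : (\int[mu]_(z in `]-oo, b]) (g z)%:E)%E \is a fin_num.
  by apply: integrable_fin_num => //; exact: gint.
rewrite /lo /Rintegral fine_le//; apply: ge0_subset_integral => //.
- by have /integrableP[] := gint (@measurable_itv R `]-oo, c']).
- by move=> z _; rewrite lee_fin.
Qed.

(** Points have measure zero, so the two half masses sum to [I] and both reach I/2 only when
    equal. *)
Let medianE c : is_median (normalize_density g) c <-> lo c = up c.
Proof.
have normE (D : set R) : measurable D ->
    \int[mu]_(z in D) normalize_density g z = (\int[mu]_(z in D) g z) / I.
  by move=> mD; rewrite /normalize_density RintegralZr//; exact: gint.
rewrite /is_median !normE//.
rewrite -Rintegral_itv_obnd_cbnd; last exact: gint.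
rewrite -/(lo c) -/(up c) !ler_pdivlMr//; have := lo_up c.
by move=> luI; split; [case|split]; lra.
Qed.

Let lo_up_m : lo m = up m. Proof. by apply/medianE; case: m_med. Qed.

(** By monotonicity lo c >= lo m = I/2 for c > m; equality would make c a second median, which
    uniqueness excludes. *)
Let median_lt c : (m < c) <-> (up c < lo c).
Proof.
have [_ m_uniq] := m_med; have uc := lo_up c; have um := lo_up m.
split=> [mc|uplo]; rewrite ltNge; apply/negP => h.
  have lmc := lo_mono (ltW mc).
  have /m_uniq cm : is_median (normalize_density g) c.
    by apply/medianE; move: lo_up_m; lra.
  by move: mc; rewrite cm ltxx.
by have := lo_mono h; move: lo_up_m; lra.
Qed.

Let EFin_integral (D : set R) : measurable D ->
  (\int[mu]_(z in D) (g z)%:E = (\int[mu]_(z in D) g z)%:E)%E.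
Proof.
move=> mD; rewrite /Rintegral fineK//.
by apply: integrable_fin_num => //; exact: gint.
Qed.

Local Open Scope ereal_scope.

Lemma median_halves :
  \int[mu]_(z in `]-oo, m]) (g z)%:E = \int[mu]_(z in `]m, +oo[) (g z)%:E.
Proof. by rewrite !EFin_integral// -/(lo m) lo_up_m. Qed.

Lemma median_half_gt0 : 0 < \int[mu]_(z in `]-oo, m]) (g z)%:E.
Proof.
rewrite EFin_integral// -/(lo m) lte_fin.
by have := lo_up m; move: lo_up_m I0; lra.
Qed.

Lemma median_half_lty : \int[mu]_(z in `]-oo, m]) (g z)%:E < +oo.
Proof. by rewrite EFin_integral// ltry. Qed.

(** Describes the sublevel sets of the median by integrals, from which its measurability in u
    follows. *)
Lemma median_ltP c : (m < c)%R <->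
  \int[mu]_(z in `]c, +oo[) (g z)%:E < \int[mu]_(z in `]-oo, c]) (g z)%:E.
Proof. by rewrite !EFin_integral// lte_fin; exact: median_lt. Qed.

End median.

(** * Law of the range and the centred maximum *)

Section max_range_law.
Context d (T : measurableType d) (R : realType) (f : R -> R).
Context (P : R * R -> probability T R) (X1 X2 : {mfun T >-> R}).
Hypothesis f_density : prob_density f.
Hypothesis model : location_model f P X1 X2.
Local Notation mu := (@lebesgue_measure R).
Local Notation GR := (measurableTypeR R).
Local Notation k := (cond_kernel f).

Let mf : measurable_fun setT f. Proof. by case: f_density. Qed.
Let f0 x : 0 <= f x. Proof. by case: f_density. Qed.

Local Open Scope ereal_scope.

(* Unnormalized P((U, Z) \in C | U = u). *)
Definition kernel_integral (t : R) (C : set (GR * GR)) (u : GR) : \bar R :=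
  \int[mu]_z (\1_C (u, z) * k t u z)%:E.

Let k0 t u z : (0 <= k t u z)%R.
Proof. by rewrite addr_ge0// mulr_ge0. Qed.

Let integrand_ge0 t (C : set (GR * GR)) u z : 0 <= (\1_C (u, z) * k t u z)%:E.
Proof. by rewrite lee_fin mulr_ge0// indicE. Qed.

Let mfGR : measurable_fun setT (f : GR -> R).
Proof. exact: mf. Qed.

Lemma measurable_cond_kernel2 t :
  measurable_fun setT (fun p : GR * GR => k t p.1 p.2).
Proof.
have m1 : measurable_fun setT (fst : GR * GR -> GR) by exact: measurable_fst.
have m2 : measurable_fun setT (snd : GR * GR -> GR) by exact: measurable_snd.
have mcst (c : R) : measurable_fun setT (fun _ : GR * GR => c).
  exact: measurable_cst.
have mB : measurable_fun setT (fun p : GR * GR => p.2 - p.1)%R.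
  exact: (measurable_funB m2 m1).
apply: measurable_funD; apply: measurable_funM.
- exact: measurableT_comp mfGR (measurable_funD mB (mcst t)).
- exact: measurableT_comp mfGR m2.
- exact: measurableT_comp mfGR mB.
- exact: measurableT_comp mfGR (measurable_funD m2 (mcst t)).
Qed.

Lemma kernel_integral_ge0 t (C : set (GR * GR)) u : 0 <= kernel_integral t C u.
Proof. by apply: integral_ge0 => z _. Qed.

Lemma measurable_kernel_integral t (C : set (GR * GR)) : measurable C ->
  measurable_fun setT (kernel_integral t C).
Proof.
move=> mC.
apply: (@measurable_fun_fubini_tonelli_F _ _ GR GR R mu
  (fun p => (\1_C p * k t p.1 p.2)%:E)).
- apply/measurable_EFinP/measurable_funM; last exact: measurable_cond_kernel2.
  exact: measurable_indic.
- by move=> [u z]; exact: integrand_ge0.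
Qed.

Lemma kernel_integral_section t (C : set (GR * GR)) u (D : set R) :
  (forall z, C (u, z) <-> D z) ->
  kernel_integral t C u = \int[mu]_(z in D) (k t u z)%:E.
Proof.
move=> CD; rewrite integral_mkcond; apply: eq_integral => z _.
rewrite patchE indicE; have [Dz|nDz] := pselect (D z).
  by rewrite !mem_set ?mul1r//; apply/CD.
by rewrite !memNset ?mul0r//; apply/CD.
Qed.

(* The densities are written in the coordinates u = y - x, z = y - M. *)
Lemma lag_law (Q : probability T R) (X Y : {mfun T >-> R}) (a b M : R)
    (C : set (GR * GR)) :
  has_density Q X (fun x => f (x - a)) ->
  has_density Q Y (fun x => f (x - b)) -> independent_rv Q X Y ->
  measurable C ->
  Q [set w | C (Y w - X w, Y w - M)%R] =
  \int[mu]_u \int[mu]_z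
    (\1_C (u, z) * (f (z - u + (M - a)) * f (z + (M - b))))%:E.
Proof.
move=> Xd Yd XY mC.
have mfs (c : R) : measurable_fun setT (fun x : GR => f (x - c)).
  by apply: measurableT_comp mfGR _; exact: measurable_funB.
have m1 : measurable_fun setT (fst : GR * GR -> GR) by exact: measurable_fst.
have m2 : measurable_fun setT (snd : GR * GR -> GR) by exact: measurable_snd.
pose lag (p : GR * GR) : GR * GR := (p.2 - p.1, p.2 - M)%R.
have mlag : measurable_fun setT lag.
  by apply: measurable_fun_pair; exact: measurable_funB.
have mB : measurable (lag @^-1` C).
  by rewrite -[X in measurable X]setTI; exact: mlag.
have := independent_joint_density (mfs a) (mfs b) (fun x => f0 _)
  (fun x => f0 _) Xd Yd XY mB.
rewrite /preimage/= => ->.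
pose h (p : GR * GR) := (\1_(lag @^-1` C) p * f (p.1 - a) * f (p.2 - b))%:E.
have mh : measurable_fun setT h.
  apply/measurable_EFinP/measurable_funM.
    apply: measurable_funM; first exact: measurable_indic.
    exact: measurableT_comp (mfs a) m1.
  exact: measurableT_comp (mfs b) m2.
have h0 p : 0 <= h p by rewrite lee_fin !mulr_ge0// indicE.
rewrite (ge0_integral_max_range M mh h0).
apply: eq_integral => u _; apply: eq_integral => z _; rewrite /h/= -mulrA.
have -> : (z + M - u - a = z - u + (M - a))%R by ring.
have -> : (z + M - b = z + (M - b))%R by ring.
congr (_ * _)%:E; rewrite !indicE; congr ((nat_of_bool _)%:R).
apply/idP/idP; rewrite !inE /lag/=.
  have -> : (z + M - (z + M - u) = u)%R by ring.
  by have -> : (z + M - M = z)%R by ring.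
have -> : (z + M - (z + M - u) = u)%R by ring.
by have -> : (z + M - M = z)%R by ring.
Qed.

Lemma independent_rvC (Q : probability T R) (X Y : T -> R) :
  independent_rv Q X Y -> independent_rv Q Y X.
Proof. by move=> XY A B mA mB; rewrite setIC XY// muleC. Qed.

(** In the coordinates of [lag_law] a tie is u = 0, so the outer integral runs over a single
    point. *)
Lemma tie_null theta : P theta [set w | X1 w = X2 w] = 0.
Proof.
have [d1 d2 ind] := model theta.
have mC : measurable [set p : GR * GR | p.1 = 0%R].
  rewrite (_ : [set p : GR * GR | p.1 = 0%R] = [set 0%R : GR] `*` [set: GR]).
    apply: measurableX => //; exact: measurable_set1.
  by apply/seteqP; split=> [p /= ->|p []].
rewrite (_ : [set w | X1 w = X2 w] = [set w | [set p : GR * GR | p.1 = 0%R]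
    (X2 w - X1 w, X2 w - 0)%R]).
  rewrite (lag_law _ d1 d2 ind mC).
  rewrite -[RHS](@integral_set1 R (fun u => \int[mu]_z
    (f (z - u + (0 - theta.1)) * f (z + (0 - theta.2)))%:E) 0%R).
  rewrite [RHS]integral_mkcond; apply: eq_integral => u _.
  rewrite patchE; case: ifPn => [|] uE.
    apply: eq_integral => z _; rewrite indicE mem_set ?mul1r//=.
    by move: uE; rewrite inE.
  apply: integral0_eq => z _; rewrite indicE memNset ?mul0r//=.
  by move=> u0; move: uE; rewrite notin_setE.
apply/seteqP; split=> w /=; first by move=> ->; rewrite subrr.
by move=> /eqP; rewrite subr_eq0 => /eqP.
Qed.

(** The event splits by which variable is larger; since [C] only contains u > 0, the two pieces are
    disjoint. Each contributes one summand of [cond_kernel] through [lag_law], the order of the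
    summands depending on the order of the parameters. *)
Lemma max_range_law theta (C : set (GR * GR)) : measurable C ->
  (forall u z, C (u, z) -> (0 < u)%R) ->
  P theta [set w | C (range2 (X1 w, X2 w),
    Num.max (X1 w) (X2 w) - Num.max theta.1 theta.2)%R] =
  \int[mu]_u kernel_integral `|theta.1 - theta.2|%R C u.
Proof.
move=> mC Cpos; have [d1 d2 ind] := model theta.
set M := Num.max theta.1 theta.2.
have setE : [set w | C (range2 (X1 w, X2 w), Num.max (X1 w) (X2 w) - M)%R] =
    [set w | C (X2 w - X1 w, X2 w - M)%R] `|`
    [set w | C (X1 w - X2 w, X1 w - M)%R].
  apply/seteqP; split=> w /=; rewrite /range2/=.
    by have [x12|x21] := leP (X1 w) (X2 w); [left|right].
  by have [x12|x21] := leP (X1 w) (X2 w); move=> []// /[dup] /Cpos; lra.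
have mlag (X Y : {mfun T >-> R}) : measurable [set w | C (Y w - X w, Y w - M)%R].
  have mX : measurable_fun setT (X : T -> GR).
    have mXR : measurable_fun setT X by [].
    exact: mXR.
  have mY : measurable_fun setT (Y : T -> GR).
    have mYR : measurable_fun setT Y by [].
    exact: mYR.
  have mXY : measurable_fun setT (fun w => (Y w - X w, Y w - M)%R : GR * GR).
    by apply: measurable_fun_pair; apply: measurable_funB.
  by rewrite -[X in measurable X]setTI; exact: mXY.
transitivity (P theta [set w | C (X2 w - X1 w, X2 w - M)%R] +
              P theta [set w | C (X1 w - X2 w, X1 w - M)%R]).
  rewrite {}setE measureU//.
  by apply/seteqP; split=> // w [/= /Cpos ? /Cpos ?]; lra.
rewrite (lag_law _ d1 d2 ind mC) (lag_law _ d2 d1 (independent_rvC ind) mC).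
have mint a b : measurable_fun setT (fun p : GR * GR =>
    (\1_C p * (f (p.2 - p.1 + (M - a)) * f (p.2 + (M - b))))%:E).
  have m1 : measurable_fun setT (fst : GR * GR -> GR) by exact: measurable_fst.
  have m2 : measurable_fun setT (snd : GR * GR -> GR) by exact: measurable_snd.
  have mcst (c : R) : measurable_fun setT (fun _ : GR * GR => c : GR).
    exact: measurable_cst.
  apply/measurable_EFinP/measurable_funM; first exact: measurable_indic.
  apply: measurable_funM; apply: measurableT_comp mfGR _.
    exact: measurable_funD (measurable_funB m2 m1) (mcst _).
  exact: measurable_funD m2 (mcst _).
have int0 a b p :
    0 <= (\1_C p * (f (p.2 - p.1 + (M - a)) * f (p.2 + (M - b))))%:E.
  by rewrite lee_fin !mulr_ge0// indicE.
rewrite -ge0_integralD//; last 4 first.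
- by move=> u _; apply: integral_ge0 => z _; exact: (int0 _ _ (u, z)).
- exact: (@measurable_fun_fubini_tonelli_F _ _ GR GR R mu _ (mint _ _) (int0 _ _)).
- by move=> u _; apply: integral_ge0 => z _; exact: (int0 _ _ (u, z)).
- exact: (@measurable_fun_fubini_tonelli_F _ _ GR GR R mu _ (mint _ _) (int0 _ _)).
have mint1 a b (u : GR) : measurable_fun setT (fun z : GR =>
    (\1_C (u, z) * (f (z - u + (M - a)) * f (z + (M - b))))%:E).
  exact: (measurableT_comp (mint a b) (pair1_measurable u)).
apply: eq_integral => u _; rewrite -ge0_integralD//.
apply: eq_integral => z _; rewrite -EFinD -mulrDr; congr (_ * _)%:E.
rewrite /cond_kernel /M; have [t12|t21] := leP theta.1 theta.2.
  by rewrite distrC ger0_norm ?subr_ge0// subrr !addr0.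
by rewrite ger0_norm ?subr_ge0 1?ltW// subrr !addr0 addrC.
Qed.

End max_range_law.

(** * Shape of the loss and the elementary bound on GPN *)

Lemma measurable_set_bool d (T : measurableType d) (b : T -> bool) :
  measurable_fun setT b -> measurable [set x | b x].
Proof.
by move=> mb; rewrite -[X in measurable X]setTI; exact: (mb measurableT [set true]).
Qed.

Section loss_shape.
Context {R : realType}.
Variable W : R -> R.
Hypotheses (W_ge0 : forall x, 0 <= W x) (W_C1 : condC1 W).

Lemma condC1_lt (x y : R) : x < y -> y <= 0 -> W y < W x.
Proof.
have [W0 Wdec _] := W_C1.
move=> xy; rewrite le_eqVlt => /predU1P[y0|/(Wdec _ _ xy)//].
rewrite y0 W0 in xy *.
(* (C1) gives strict decrease on the open half-line only; the midpoint bridges to 0 because 0 <=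
   W(x/2). *)
have : W (x / 2) < W x by apply: Wdec; lra.
exact: le_lt_trans.
Qed.

(** The loss is a difference of two nondecreasing functions, one carrying each half-line. *)
Lemma condC1_measurable : measurable_fun setT W.
Proof.
have [W0 Wdec Winc] := W_C1.
pose Wp x := if 0 < x then W x else 0.
pose Wn x := if x < 0 then - W x else 0.
have WE : W = Wp \- Wn.
  apply/funext => x; rewrite /Wp /Wn /=.
  by case: (ltgtP x 0) => [||->]; rewrite ?(subr0, sub0r, opprK).
rewrite WE; apply: measurable_funB; apply: nondecreasing_measurable => // x y xy;
  rewrite /Wp /Wn.
- have [x0|x0] := ltP 0 x; last by case: ifP.
  rewrite (lt_le_trans x0 xy); move: xy; rewrite le_eqVlt.
  by move=> /predU1P[->//|xy]; exact/ltW/Winc.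
- have [y0|y0] := ltP y 0; last by case: ifP => // _; rewrite oppr_le0.
  rewrite (le_lt_trans xy y0) lerN2; move: xy; rewrite le_eqVlt.
  by move=> /predU1P[->//|xy]; exact/ltW/Wdec.
Qed.

End loss_shape.

(** With l, p, v the probabilities of [lower], [upper], [V], the GPN is at least l + (1 - v)/2 >=
    1/2 + (l - p)/2. *)
Lemma half_le_gpn d (T : measurableType d) (R : realType) (Q : probability T R)
    (better equal V lower upper : set T) :
  measurable better -> measurable equal -> measurable V -> measurable lower ->
  measurable upper -> lower `<=` better -> ~` V `<=` equal ->
  (Q V <= Q lower + Q upper)%E ->
  ((Q upper <= Q lower)%E -> ((2^-1)%:E <= Q better + (2^-1)%:E * Q equal)%E) /\
  ((Q upper < Q lower)%E -> ((2^-1)%:E < Q better + (2^-1)%:E * Q equal)%E).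
Proof.
move=> mB mE mV mL mU LB VE VLU.
have QL : (Q lower <= Q better)%E by apply: le_measure; rewrite ?inE.
have QV : (1 - Q V <= Q equal)%E.
  rewrite -probability_setC//; apply: le_measure; rewrite ?inE//.
  exact: measurableC.
have finQ A : measurable A -> exists a, Q A = a%:E.
  by move=> mA; exists (fine (Q A)); rewrite fineK// fin_num_measure.
have [[b Eb] [e Ee]] := (finQ _ mB, finQ _ mE).
have [[l El] [p Ep]] := (finQ _ mL, finQ _ mU).
have [v Ev] := finQ _ mV.
move: QL QV VLU; rewrite {}Eb {}Ee {}El {}Ep {}Ev.
rewrite -EFinM -!EFinD !lee_fin !lte_fin => QL QV VLU.
by split; lra.
Qed.

(** * Measurability of the median in u, and the comparison for each value of the range *)

Section pitman_comparison.
Context (R : realType) (f : R -> R) (m : R -> R) (c0 : R).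
Hypotheses (f_density : prob_density f) (f_MLR : MLR f).
Hypothesis m_median : forall u, 0 < u -> is_cond_median f 0 u (m u).
Local Notation mu := (@lebesgue_measure R).
Local Notation GR := (measurableTypeR R).
Local Notation k := (cond_kernel f).

(* [m] is unconstrained on negative arguments, which the range never takes. *)
Definition median0 (u : R) : R := if 0 < u then m u else m 0.

Lemma median0E u : 0 <= u -> median0 u = m u.
Proof. by rewrite le_eqVlt /median0 => /predU1P[<-|->//]; rewrite ltxx. Qed.

(** For u > 0, [median_ltP] writes m(u) < c as an inequality between two kernel integrals, which are
    measurable in u by Tonelli; elsewhere [median0] is constant. *)
Lemma measurable_median0 : measurable_fun setT (median0 : GR -> R).
Proof.
have m2 : measurable_fun setT (snd : GR * GR -> R) by exact: measurable_snd.
apply: (measurability _ (RGenInftyO.measurableE R)) => //.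
move=> _ [_ [c ->] <-]; rewrite setTI.
pose lo := [set p : GR * GR | p.2 <= c].
pose up := [set p : GR * GR | c < p.2].
have mlo : measurable lo.
  by apply: measurable_set_bool; apply: measurable_fun_ler.
have mup : measurable up.
  by apply: measurable_set_bool; apply: measurable_fun_ltr.
have upE u : kernel_integral f 0 up u = (\int[mu]_(z in `]c, +oo[) (k 0 u z)%:E)%E.
  by apply: kernel_integral_section => z; rewrite /up/= in_itv/= andbT.
have loE u : kernel_integral f 0 lo u = (\int[mu]_(z in `]-oo, c]) (k 0 u z)%:E)%E.
  by apply: kernel_integral_section => z; rewrite /lo/= in_itv/=.
have m_lt u : 0 < u ->
    m u < c <-> (kernel_integral f 0 up u < kernel_integral f 0 lo u)%E.
  move=> u0; have [un um] := m_median u0; rewrite upE loE.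
  by apply: median_ltP => //; exact: cond_kernel_ge0.
rewrite (_ : _ @^-1` _ =
  [set u : GR | (0 < u) && (kernel_integral f 0 up u < kernel_integral f 0 lo u)%E]
  `|` [set u : GR | ~~ (0 < u) && (m 0 < c)]).
  have mpos : measurable_fun setT (fun u : GR => 0 < u).
    by apply: measurable_fun_ltr => //; exact: measurable_cst.
  apply: measurableU; apply: measurable_set_bool; apply: measurable_and => //.
  - by apply: measurable_fun_lte; exact: measurable_kernel_integral.
  - exact: measurable_neg.
apply/seteqP; split => u /=; rewrite in_itv/= /median0.
  by case: (boolP (0 < u)) => u0; [move/(m_lt _ u0); left|right].
by case: (boolP (0 < u)) => u0 /= []// /(m_lt _ u0).
Qed.

(** Values of (U, Z) for which the new estimator is certain to win; [upper_region] is the rest of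
    {m(U) < c0}, where nothing is claimed. *)
Definition lower_region : set (GR * GR) :=
  [set p | [&& 0 < p.1, median0 p.1 < c0 & p.2 <= median0 p.1]].

Definition upper_region : set (GR * GR) :=
  [set p | [&& 0 < p.1, median0 p.1 < c0 & median0 p.1 < p.2]].

Lemma measurable_regions : measurable lower_region /\ measurable upper_region.
Proof.
have m1 : measurable_fun setT (fst : GR * GR -> R) by exact: measurable_fst.
have m2 : measurable_fun setT (snd : GR * GR -> R) by exact: measurable_snd.
have mm : measurable_fun setT (fun p : GR * GR => median0 p.1).
  exact: measurableT_comp measurable_median0
    (measurable_fst : measurable_fun _ (fst : GR * GR -> GR)).
have mcst (c : R) : measurable_fun setT (fun _ : GR * GR => c).
  exact: measurable_cst.
split; apply: measurable_set_bool; apply: measurable_and;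
  do 1?[exact: measurable_fun_ltr]; apply: measurable_and;
  do 1?[exact: measurable_fun_ltr].
exact: measurable_fun_ler.
Qed.

(** Otherwise k_0(u, .) would vanish identically, against its positive total mass. *)
Lemma cond_median_support (u : R) : 0 < u -> exists2 z, 0 < f (z - u) & 0 < f z.
Proof.
move=> u0; have [[_ Ik] _] := m_median u0; apply: contrapT => H.
move: Ik; rewrite (_ : \int[mu]_z _ = 0) ?ltxx//.
rewrite /Rintegral integral0_eq// => z _; congr EFin.
have [_ f0 _] := f_density.
rewrite /cond_kernel !addr0 (_ : f (z - u) * f z = 0) ?addr0//.
apply/eqP; rewrite eq_le mulr_ge0// andbT leNgt; apply/negP => h.
have fz0 : f z != 0 by apply: contraTneq h => ->; rewrite mulr0 ltxx.
have fzu0 : f (z - u) != 0 by apply: contraTneq h => ->; rewrite mul0r ltxx.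
by apply: H; exists z; rewrite lt_neqAle eq_sym ?fz0 ?fzu0 f0.
Qed.

Local Open Scope ereal_scope.

Lemma kernel_integral_regions (t u : R) : (0 < u)%R -> (m u < c0)%R ->
  kernel_integral f t lower_region u = \int[mu]_(z in `]-oo, m u]) (k t u z)%:E /\
  kernel_integral f t upper_region u = \int[mu]_(z in `]m u, +oo[) (k t u z)%:E.
Proof.
move=> u0 mc; split; apply: kernel_integral_section => z;
  by rewrite /lower_region /upper_region /= in_itv/= /median0 u0 mc ?andbT.
Qed.

Lemma kernel_integral_regions0 (t u : R) : ~ ((0 < u)%R /\ (m u < c0)%R) ->
  kernel_integral f t lower_region u = 0 /\ kernel_integral f t upper_region u = 0.
Proof.
move=> H; rewrite !(@kernel_integral_section _ _ _ _ _ set0) ?integral_set0//;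
  by move=> z; split=> // /and3P[u0]; rewrite /median0 u0 => mc _; apply: H.
Qed.

Lemma kernel_integral_le (t u : R) : (0 <= t)%R ->
  kernel_integral f t upper_region u <= kernel_integral f t lower_region u.
Proof.
move=> t0; have [[u0 mc]|] := pselect ((0 < u)%R /\ (m u < c0)%R); last first.
  by move=> /(kernel_integral_regions0 t)[-> ->].
have [-> ->] := kernel_integral_regions t u0 mc.
have [un um] := m_median u0.
have k0 z : (0 <= k 0 u z)%R by exact: cond_kernel_ge0.
apply: upper_le_lower => //.
- exact: median_halves um.
- exact: median_half_gt0 um.
- exact: median_half_lty un.
Qed.

Lemma kernel_integral_lt (t u : R) : (0 < t <= u)%R -> (m u < c0)%R ->
  kernel_integral f t upper_region u < +oo ->
  kernel_integral f t upper_region u < kernel_integral f t lower_region u.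
Proof.
move=> /andP[t0 tu] mc; have u0 := lt_le_trans t0 tu.
have [-> ->] := kernel_integral_regions t u0 mc.
have [un um] := m_median u0.
have k0 z : (0 <= k 0 u z)%R by exact: cond_kernel_ge0.
apply: (@upper_lt_lower _ f f_density f_MLR t u (m u) (ltW t0)).
- exact: median_halves um.
- exact: median_half_gt0 um.
- exact: median_half_lty un.
- by rewrite t0.
- exact: cond_median_support.
Qed.

End pitman_comparison.

(** * Assembly: the weak inequality everywhere, then strictness at a nearby pair of parameters *)

Theorem corollary4p6 (R : realType) (d : measure_display)
    (T : measurableType d)
    (f : R -> R) (P : R * R -> probability T R) (X1 X2 : {mfun T >-> R})
    (W : R -> R) (c0 : R) (m : R -> R)
    (f_density : prob_density f)
    (model : location_model f P X1 X2)
    (f_MLR : MLR f)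
    (W_ge0 : forall x, 0 <= W x)
    (W_C1 : condC1 W) (W_C2 : condC2 W) (W_C3 : condC3 W f)
    (c0_root : score W f c0 = 0)
    (c0_unique : forall c, score W f c = 0 -> c = c0)
    (m_median : forall u, 0 < u -> is_cond_median f 0 u (m u))
    (m_lt_c0 : exists theta : R * R,
      P theta [set w | m (range2 (X1 w, X2 w)) < c0] <> 0%E) :
  pitman_nearer P (fun w => (X1 w, X2 w)) W (delta_PN c0 m) (delta_usual c0).
Proof.
pose mu := @lebesgue_measure R; pose GR := measurableTypeR R.
have [mlow mupp] := measurable_regions c0 f_density m_median.
set low := lower_region m c0 in mlow; set upp := upper_region m c0 in mupp.
pose U w := range2 (X1 w, X2 w).
pose Z theta w := Num.max (X1 w) (X2 w) - Num.max theta.1 theta.2.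
pose dist (theta : R * R) := `|theta.1 - theta.2|.
have U_ge0 w : 0 <= U w by rewrite subr_ge0 ge_min !le_max lexx.
have mX1 : measurable_fun setT X1 by [].
have mX2 : measurable_fun setT X2 by [].
have mmax : measurable_fun setT (fun w => Num.max (X1 w) (X2 w)).
  exact: measurable_maxr.
have mU : measurable_fun setT U.
  by apply: measurable_funB => //; exact: measurable_minr.
have mcst (c : R) : measurable_fun setT (fun _ : T => c) by exact: measurable_cst.
(* Measurability passes through [median0], which agrees with [m] on the nonnegative values of the
   range. *)
have mmU : measurable_fun setT (fun w => m (U w)).
  apply: (eq_measurable_fun (median0 m \o U)).
    by move=> w _; rewrite /= median0E.
  exact: measurableT_comp (measurable_median0 f_density m_median) mU.
have mW := condC1_measurable W_ge0 W_C1.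
have mZ theta : measurable_fun setT (Z theta) by exact: measurable_funB.
have mUZ theta : measurable_fun setT (fun w => (U w, Z theta w) : GR * GR).
  by apply: measurable_fun_pair; [exact: mU|exact: mZ].
pose Lw theta := [set w | low (U w, Z theta w)].
pose Uw theta := [set w | upp (U w, Z theta w)].
pose V := [set w | m (U w) < c0].
have mV : measurable V by apply: measurable_set_bool; exact: measurable_fun_ltr.
have mLw theta : measurable (Lw theta).
  by rewrite -[X in measurable X]setTI; exact: mUZ.
have mUw theta : measurable (Uw theta).
  by rewrite -[X in measurable X]setTI; exact: mUZ.
have LwE theta : P theta (Lw theta) =
    (\int[mu]_u kernel_integral f (dist theta) low u)%E.
  by apply: (max_range_law f_density model) => // u z /and3P[].
have UwE theta : P theta (Uw theta) =
    (\int[mu]_u kernel_integral f (dist theta) upp u)%E.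
  by apply: (max_range_law f_density model) => // u z /and3P[].
(* The two regions cover [V] except where U = 0, that is, on the null event of ties. *)
have VLU theta : (P theta V <= P theta (Lw theta) + P theta (Uw theta))%E.
  have mtie : measurable [set w | X1 w = X2 w].
    rewrite (_ : [set _ | _] = [set w | X1 w == X2 w]).
      by apply: measurable_set_bool; exact: measurable_fun_eqr.
    by apply/seteqP; split=> w /= /eqP.
  rewrite -[leRHS]adde0 -(tie_null f_density model theta).
  apply: le_trans (leeD (measureU2 _ _ _) (lexx _)) => //.
  apply: le_trans (measureU2 _ _ _) => //; last exact: measurableU.
  apply: le_measure; rewrite ?inE//; first by do 2 apply: measurableU => //.
  move=> w Vw /=; have [Uw0|Uw0] := ltP 0 (U w).
    left; have [zm|mz] := leP (Z theta w) (m (U w)); [left|right];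
      by rewrite /Lw /Uw /low /upp /lower_region /upper_region /=
        median0E// Uw0 Vw.
  right; apply/eqP; move: Uw0; rewrite /U /range2/= subr_le0.
  rewrite ge_max !le_min !lexx /= andbT => /andP[].
  by rewrite eq_le => -> ->.
have lossP theta w : loss W theta (delta_PN c0 m (X1 w, X2 w)) =
    W (Z theta w - Num.min c0 (m (U w))).
  by rewrite /loss /delta_PN/= addrAC.
have lossU theta w : loss W theta (delta_usual c0 (X1 w, X2 w)) = W (Z theta w - c0).
  by rewrite /loss /delta_usual/= addrAC.
have mlossP theta : measurable_fun setT
    (fun w => loss W theta (delta_PN c0 m (X1 w, X2 w))).
  under eq_fun do rewrite lossP.
  apply: measurableT_comp mW _; apply: measurable_funB => //.
  exact: measurable_minr.
have mlossU theta : measurable_fun setT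
    (fun w => loss W theta (delta_usual c0 (X1 w, X2 w))).
  under eq_fun do rewrite lossU.
  by apply: measurableT_comp mW _; exact: measurable_funB.
have key theta : ((P theta (Uw theta) <= P theta (Lw theta))%E ->
      ((2^-1)%:E <= GPN P (fun w => (X1 w, X2 w)) W (delta_PN c0 m)
        (delta_usual c0) theta)%E) /\
    ((P theta (Uw theta) < P theta (Lw theta))%E ->
      ((2^-1)%:E < GPN P (fun w => (X1 w, X2 w)) W (delta_PN c0 m)
        (delta_usual c0) theta)%E).
  apply: (half_le_gpn (V := V)) => //.
  - by apply: measurable_set_bool; exact: measurable_fun_ltr.
  - rewrite (_ : [set _ | _] = [set w | loss W theta (delta_PN c0 m (X1 w, X2 w))
        == loss W theta (delta_usual c0 (X1 w, X2 w))]).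
      by apply: measurable_set_bool; exact: measurable_fun_eqr.
    by apply/seteqP; split=> w /= /eqP.
  (* Here Z - c0 < Z - m(U) <= 0, and the loss strictly decreases up to 0. *)
  - move=> w; rewrite /Lw /low /lower_region /= median0E// => /and3P[_ mc zm].
    rewrite lossP lossU minEle leNgt mc /=; apply: condC1_lt => //; lra.
  - move=> w /= /negP; rewrite -leNgt => cm.
    by rewrite lossP lossU minEle cm.
have mK t C : measurable C -> measurable_fun setT (kernel_integral f t C).
  exact: measurable_kernel_integral.
have K0 t C u : (0 <= kernel_integral f t C u)%E by exact: kernel_integral_ge0.
have UL theta : (P theta (Uw theta) <= P theta (Lw theta))%E.
  rewrite LwE UwE; apply: ge0_le_integral => //; [exact: mK|exact: mK|].
  by move=> u _; apply: kernel_integral_le => //; exact: normr_ge0.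
split=> [theta|]; first exact: (key theta).1.
have [theta0 V0] := m_lt_c0.
(* If the lower event were null, so would be the upper one by [UL], and then [V] by [VLU]. *)
have L0 : P theta0 (Lw theta0) <> 0%E.
  move=> L0; apply: V0; apply/eqP; rewrite eq_le measure_ge0 andbT.
  apply: (le_trans (VLU theta0)); rewrite L0 add0e.
  by have := UL theta0; rewrite L0.
(* These sets exhaust {u > 0, m(u) < c0}. Keeping u away from 0 lets a single t = 1/(n + 1) satisfy
   t <= u on a set of positive measure, as [kernel_integral_lt] requires. *)
pose A n := [set u : GR | n.+1%:R^-1 <= u /\ m u < c0].
have [n An] : exists n, ~ mu.-negligible (A n).
  apply/existsNP => Anull; apply: L0; rewrite LwE.
  have Aall : mu.-negligible (\bigcup_n A n) by exact: negligible_bigcup.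
  rewrite (ae_eq_integral (cst 0%E)) ?integral0//; first exact: mK.
  apply: negligibleS Aall => u /= /not_implyP[_ Ku].
  apply: contrapT => nA; apply: Ku.
  apply: (kernel_integral_regions0 f (dist theta0) (_ : ~ (0 < u /\ m u < c0))).1.
  move=> [u0 mc]; apply: nA; exists (Num.truncn u^-1) => //; split=> //.
  by rewrite invf_ple ?posrE//; exact/ltW/Num.Theory.truncnS_gt.
pose t : R := n.+1%:R^-1; pose theta : R * R := (0, t).
have t0 : 0 < t by rewrite invr_gt0.
have distE : dist theta = t by rewrite /dist/= sub0r normrN gtr0_norm.
exists theta; apply: (key theta).2; rewrite ltNge; apply/negP => LU.
apply: An; rewrite LwE UwE distE in LU.
have Loo : (\int[mu]_u kernel_integral f t low u < +oo)%E.
  by rewrite -distE -LwE ltey_eq fin_num_measure.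
have low_fin : mu.-integrable setT (kernel_integral f t low).
  apply/integrableP; split; first exact: mK.
  by under eq_integral do rewrite gee0_abs//.
have eq_ae : ae_eq mu setT (kernel_integral f t low) (kernel_integral f t upp).
  apply: ge0_le_integral_ae_eq => //; [exact: mK|exact: mK|].
  by apply: aeW => u _; apply: kernel_integral_le => //; exact: ltW.
(* Any u in [A n] at which the two kernel integrals agree and are finite contradicts
   [kernel_integral_lt], so [A n] would be negligible. *)
apply: negligibleS (negligibleU eq_ae (integrable_ae measurableT low_fin)).
move=> u [tu mc] /=; apply: contrapT => /not_orP[/contrapT eqK /contrapT finK].
have := @kernel_integral_lt R f m c0 f_density f_MLR m_median t u.
rewrite t0 tu => /(_ isT mc); rewrite -/low -/upp -(eqK I) ltxx.
by rewrite ltey_eq finK// => /(_ isT).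
Qed.
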